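(* Let $n\le r$, let $s=\gcd(r+1,n-1)$ and suppose $s>1$; write $n-1=xs$ and $r+1=(x+z)s$. Then the center of the quasi-Laurent polynomial algebra generated by the $nr$ quantum minors $\chi_{\alpha,j}\in\mathcal D_{q^2}(M(n,r))$ is generated by the following $s-1$ elements (and their inverses): $$Z_i=\prod_{k=0}^{x-1}(\chi_{n-1-ks,\,r})^{-1}\prod_{k=0}^{x-1}\chi_{n-1-i-ks,\,r}\prod_{j=1}^{x+z-1}(\chi_{n,\,js})^{-1}\prod_{l=0}^{x+z-1}\chi_{n,\,i+ls},\qquad i=1,\dots,s-1.$$
   Context: Let $n,r$ be positive integers and $q\in\mathbb C\setminus\{0\}$ not a root of unity. $\mathcal O_q(M(n,r))$ is the $\mathbb C$-algebra generated by $Z_{\alpha j}$ ($1\le\alpha\le n$, $1\le j\le r$) with relations: $Z_{\alpha j}Z_{\alpha k}=qZ_{\alpha k}Z_{\alpha j}$ ($j<k$); $Z_{\alpha j}Z_{\beta j}=qZ_{\beta j}Z_{\alpha j}$ ($\alpha<\beta$); $Z_{\alpha j}Z_{\beta l}=Z_{\beta l}Z_{\alpha j}$ ($\alpha>\beta,\ j<l$); $Z_{\alpha j}Z_{\beta l}=Z_{\beta l}Z_{\alpha j}+(q-q^{-1})Z_{\alpha l}Z_{\beta j}$ ($\alpha<\beta,\ j<l$). Adjoin mutually commuting invertible $R_\alpha,C_j$ with $R_\alpha Z_{\beta i}=q^{\delta_{\alpha\beta}}Z_{\beta i}R_\alpha$, $C_jZ_{\alpha i}=q^{\delta_{ij}}Z_{\alpha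 i}C_j$. With $M_{\alpha j}=R_{\alpha+1}\cdots R_nC_{j+1}^{-1}\cdots C_r^{-1}$, the Dipper–Donkin algebra $\mathcal D_{q^2}(M(n,r))$ is the subalgebra generated by $W_{\alpha j}=Z_{\alpha j}M_{\alpha j}$. For $\boldsymbol\alpha=\{\alpha_1<\dots<\alpha_m\}$, $\mathbf j=\{j_1<\dots<j_m\}$ let $\xi^{\boldsymbol\alpha}_{\mathbf j}=\sum_{\sigma\in S_m}(-q)^{\ell(\sigma)}Z_{\alpha_1,j_{\sigma(1)}}\cdots Z_{\alpha_m,j_{\sigma(m)}}$ and let the quantum minor $\chi^{\boldsymbol\alpha}_{\mathbf j}\in\mathcal D_{q^2}(M(n,r))$ be $\xi^{\boldsymbol\alpha}_{\mathbf j}M_{\alpha_1j_1}\cdots M_{\alpha_mj_m}$ times a suitable power of $q$ (irrelevant here). Put $\chi_{\alpha,j}=\chi^{\{\alpha-j+1,\dots,\alpha\}}_{\{1,\dots,j\}}$ if $\alpha\ge j$ and $\chi_{\alpha,j}=\chi^{\{1,\dots,\alpha\}}_{\{j-\alpha+1,\dots,j\}}$ if $\alpha<j$. These $nr$ elements satisfy $\chi_{\alpha,j}\chi_{\beta,k}=q^{\Lambda_{\alpha j,\beta k}}\chi_{\beta,k}\chi_{\alpha,j}$ with $\Lambda=\mathbb T^t(2H_D)\mathbb T$. Here $H_D$ is the $nr\times nr$ matrix of $n\times n$ blocks of size $r\times r$ with diagonal blocks $0$, blocks $M_r$ above and $N_r$ below the diagonal, where $N_r$ has all entries on and above the diagonal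 $-1$ and zeros below, $M_r=-N_r^t$; and $\mathbb T$ is block upper triangular with $(\alpha,\beta)$ block $T^{\beta-\alpha}$ for $\alpha\le\beta$, $T=\sum_{i=1}^{r-1}E_{i,i+1}$. The quasi-Laurent polynomial algebra generated by the $\chi_{\alpha,j}$ is the algebra generated by the $\chi_{\alpha,j}^{\pm1}$ subject to these $q$-commutation relations. The order of factors in a monomial only affects it by a power of $q$. *)

(* Defs.v *)
From HB Require Import structures.
From mathcomp Require Import all_boot all_order all_algebra.
From mathcomp Require Import generic_quotient.
From mathcomp Require Import boolp.

Set Implicit Arguments.
Unset Strict Implicit.
Unset Printing Implicit Defensive.

Import Order.TTheory GRing.Theory Num.Theory.

Local Open Scope ring_scope.
Local Open Scope quotient_scope.

(* K-algebras given by generators and relations: formal expressions in the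
   generators, modulo the least congruence containing the axioms of unital
   associative K-algebras and the given relations.  The result carries
   [pzRingType] and [lmodType K] structures, and not [algType K], because
   MathComp requires 1 != 0 of an [algType]. *)

Inductive term (K X : Type) : Type :=
| TGen of X
| TZero
| TOpp of term K X
| TAdd of term K X & term K X
| TScale of K & term K X
| TOne
| TMul of term K X & term K X.

Arguments TGen {K X}.
Arguments TZero {K X}.
Arguments TOne {K X}.

Inductive pres_eq (K : comPzRingType) (X : Type)
    (rel : term K X -> term K X -> Prop) : term K X -> term K X -> Prop :=
| PE_rel s t : rel s t -> pres_eq rel s t
| PE_refl s : pres_eq rel s s
| PE_sym s t : pres_eq rel s t -> pres_eq rel t s
| PE_trans s t u : pres_eq rel s t -> pres_eq rel t u -> pres_eq rel s u
| PE_opp s s' : pres_eq rel s s' -> pres_eq rel (TOpp s) (TOpp s')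
| PE_add s s' t t' : pres_eq rel s s' -> pres_eq rel t t' ->
    pres_eq rel (TAdd s t) (TAdd s' t')
| PE_scale a s s' : pres_eq rel s s' -> pres_eq rel (TScale a s) (TScale a s')
| PE_mul s s' t t' : pres_eq rel s s' -> pres_eq rel t t' ->
    pres_eq rel (TMul s t) (TMul s' t')
| PE_addA s t u : pres_eq rel (TAdd s (TAdd t u)) (TAdd (TAdd s t) u)
| PE_addC s t : pres_eq rel (TAdd s t) (TAdd t s)
| PE_add0 s : pres_eq rel (TAdd TZero s) s
| PE_addN s : pres_eq rel (TAdd (TOpp s) s) TZero
| PE_mulA s t u : pres_eq rel (TMul s (TMul t u)) (TMul (TMul s t) u)
| PE_mul1l s : pres_eq rel (TMul TOne s) s
| PE_mul1r s : pres_eq rel (TMul s TOne) s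
| PE_mulDl s t u :
    pres_eq rel (TMul (TAdd s t) u) (TAdd (TMul s u) (TMul t u))
| PE_mulDr s t u :
    pres_eq rel (TMul s (TAdd t u)) (TAdd (TMul s t) (TMul s u))
| PE_scaleA a b s : pres_eq rel (TScale a (TScale b s)) (TScale (a * b) s)
| PE_scale1 s : pres_eq rel (TScale 1 s) s
| PE_scaleDr a s t :
    pres_eq rel (TScale a (TAdd s t)) (TAdd (TScale a s) (TScale a t))
| PE_scaleDl a b s :
    pres_eq rel (TScale (a + b) s) (TAdd (TScale a s) (TScale b s))
| PE_scaleAl a s t : pres_eq rel (TScale a (TMul s t)) (TMul (TScale a s) t)
| PE_scaleAr a s t : pres_eq rel (TScale a (TMul s t)) (TMul s (TScale a t)).

Section Presentation.
Variables (K : comPzRingType) (X : Type) (rel : term K X -> term K X -> Prop).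

HB.instance Definition _ := gen_eqMixin (term K X).
HB.instance Definition _ := gen_choiceMixin (term K X).

Definition pres_eqb (s t : term K X) : bool := `[< pres_eq rel s t >].

Lemma pres_eqb_refl : reflexive pres_eqb.
Proof. by move=> s; apply/asboolP; apply: PE_refl. Qed.

Lemma pres_eqb_sym : symmetric pres_eqb.
Proof. by move=> s t; apply: asbool_equiv_eq; split; apply: PE_sym. Qed.

Lemma pres_eqb_trans : transitive pres_eqb.
Proof.
move=> t s u /asboolP st /asboolP tu; apply/asboolP; exact: PE_trans st tu.
Qed.

Definition pres_equiv : equiv_rel (term K X) :=
  EquivRel pres_eqb pres_eqb_refl pres_eqb_sym pres_eqb_trans.

Definition pres_alg : Type := {eq_quot pres_equiv}.
HB.instance Definition _ := Choice.on pres_alg.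

Definition pres_class (s : term K X) : pres_alg := \pi_({eq_quot pres_equiv}) s.
Definition pres_repr (u : pres_alg) : term K X :=
  repr (u : {eq_quot pres_equiv}).

Lemma pres_reprK : cancel pres_repr pres_class.
Proof. by move=> u; rewrite /pres_class /pres_repr reprK. Qed.

Lemma pres_classP s t : pres_class s = pres_class t <-> pres_eq rel s t.
Proof.
split=> [/eqmodP/asboolP //|st]; apply/eqmodP; exact/asboolP.
Qed.

Lemma pres_repr_class s : pres_eq rel (pres_repr (pres_class s)) s.
Proof. by apply/pres_classP; rewrite pres_reprK. Qed.

Definition pres_opp (u : pres_alg) : pres_alg := pres_class (TOpp (pres_repr u)).
Definition pres_add (u v : pres_alg) : pres_alg :=
  pres_class (TAdd (pres_repr u) (pres_repr v)).
Definition pres_scale (a : K) (u : pres_alg) : pres_alg :=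
  pres_class (TScale a (pres_repr u)).
Definition pres_mul (u v : pres_alg) : pres_alg :=
  pres_class (TMul (pres_repr u) (pres_repr v)).

Lemma pres_class_opp s : pres_class (TOpp s) = pres_opp (pres_class s).
Proof. apply/pres_classP/PE_opp/PE_sym; exact: pres_repr_class. Qed.

Lemma pres_class_add s t :
  pres_class (TAdd s t) = pres_add (pres_class s) (pres_class t).
Proof. by apply/pres_classP/PE_add; apply/PE_sym/pres_repr_class. Qed.

Lemma pres_class_scale a s :
  pres_class (TScale a s) = pres_scale a (pres_class s).
Proof. by apply/pres_classP/PE_scale/PE_sym/pres_repr_class. Qed.

Lemma pres_class_mul s t :
  pres_class (TMul s t) = pres_mul (pres_class s) (pres_class t).
Proof. by apply/pres_classP/PE_mul; apply/PE_sym/pres_repr_class. Qed.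

Let classE := (pres_class_opp, pres_class_add, pres_class_scale, pres_class_mul).

Fact pres_addA : associative pres_add.
Proof.
move=> u v w; rewrite -(pres_reprK u) -(pres_reprK v) -(pres_reprK w) -!classE.
exact/pres_classP/PE_addA.
Qed.
Fact pres_addC : commutative pres_add.
Proof.
move=> u v; rewrite -(pres_reprK u) -(pres_reprK v) -!classE.
exact/pres_classP/PE_addC.
Qed.
Fact pres_add0 : left_id (pres_class TZero) pres_add.
Proof.
by move=> u; rewrite -(pres_reprK u) -!classE; apply/pres_classP/PE_add0.
Qed.
Fact pres_addN : left_inverse (pres_class TZero) pres_opp pres_add.
Proof.
by move=> u; rewrite -(pres_reprK u) -!classE; apply/pres_classP/PE_addN.
Qed.
Fact pres_mulA : associative pres_mul.
Proof.
move=> u v w; rewrite -(pres_reprK u) -(pres_reprK v) -(pres_reprK w) -!classE.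
exact/pres_classP/PE_mulA.
Qed.
Fact pres_mul1l : left_id (pres_class TOne) pres_mul.
Proof.
by move=> u; rewrite -(pres_reprK u) -!classE; apply/pres_classP/PE_mul1l.
Qed.
Fact pres_mul1r : right_id (pres_class TOne) pres_mul.
Proof.
by move=> u; rewrite -(pres_reprK u) -!classE; apply/pres_classP/PE_mul1r.
Qed.
Fact pres_mulDl : left_distributive pres_mul pres_add.
Proof.
move=> u v w; rewrite -(pres_reprK u) -(pres_reprK v) -(pres_reprK w) -!classE.
exact/pres_classP/PE_mulDl.
Qed.
Fact pres_mulDr : right_distributive pres_mul pres_add.
Proof.
move=> u v w; rewrite -(pres_reprK u) -(pres_reprK v) -(pres_reprK w) -!classE.
exact/pres_classP/PE_mulDr.
Qed.

HB.instance Definition _ := GRing.isPzRing.Build pres_alg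
  pres_addA pres_addC pres_add0 pres_addN
  pres_mulA pres_mul1l pres_mul1r pres_mulDl pres_mulDr.

Fact pres_scaleA a b (u : pres_alg) :
  pres_scale a (pres_scale b u) = pres_scale (a * b) u.
Proof. by rewrite -(pres_reprK u) -!classE; apply/pres_classP/PE_scaleA. Qed.
Fact pres_scale1 : left_id 1 pres_scale.
Proof.
by move=> u; rewrite -(pres_reprK u) -!classE; apply/pres_classP/PE_scale1.
Qed.
Fact pres_scaleDr : right_distributive pres_scale +%R.
Proof.
move=> a u v; rewrite -(pres_reprK u) -(pres_reprK v) /GRing.add/= -!classE.
exact/pres_classP/PE_scaleDr.
Qed.
Fact pres_scaleDl (u : pres_alg) :
  {morph pres_scale^~ u : a b / a + b}.
Proof.
move=> a b /=; rewrite -(pres_reprK u) /(_ + _ : pres_alg)/= -!classE.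
exact/pres_classP/PE_scaleDl.
Qed.

HB.instance Definition _ := GRing.Zmodule_isLmodule.Build K pres_alg
  pres_scaleA pres_scale1 pres_scaleDr pres_scaleDl.

Lemma pres_scalerAl (a : K) (u v : pres_alg) : a *: (u * v) = (a *: u) * v.
Proof.
rewrite -(pres_reprK u) -(pres_reprK v) /GRing.mul /GRing.scale/= -!classE.
exact/pres_classP/PE_scaleAl.
Qed.
Lemma pres_scalerAr (a : K) (u v : pres_alg) : a *: (u * v) = u * (a *: v).
Proof.
rewrite -(pres_reprK u) -(pres_reprK v) /GRing.mul /GRing.scale/= -!classE.
exact/pres_classP/PE_scaleAr.
Qed.

Definition pres_gen (x : X) : pres_alg := pres_class (TGen x).

Inductive subalg_gen (G : pres_alg -> Prop) : pres_alg -> Prop :=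
| SG_gen u : G u -> subalg_gen G u
| SG_one : subalg_gen G 1
| SG_lin (a : K) u v :
    subalg_gen G u -> subalg_gen G v -> subalg_gen G (a *: u + v)
| SG_mul u v : subalg_gen G u -> subalg_gen G v -> subalg_gen G (u * v).

End Presentation.

Definition central (A : pzRingType) (u : A) : Prop := forall v, GRing.comm u v.

Definition is_inverse (A : pzRingType) (u v : A) : Prop :=
  u * v = 1 /\ v * u = 1.

Definition blockN (r : nat) : 'M[int]_r :=
  \matrix_(i, j) (if (i <= j)%N then -1 else 0).

Definition blockM (r : nat) : 'M[int]_r := - (blockN r)^T.

(* Rows and columns of the nr x nr matrices below are indexed by
   [tagnat.Rank a j], the position of entry j of block a. *)

Definition HD (n r : nat) : 'M[int]_(\sum_(a < n) r) :=
  \mxblock_(a < n, b < n)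
    (if (a < b)%N then blockM r else if (b < a)%N then blockN r else 0).

Definition shiftT (r : nat) : 'M[int]_r :=
  \matrix_(i, j) (if (j == i.+1 :> nat)%N then 1 else 0).

Definition bigT (n r : nat) : 'M[int]_(\sum_(a < n) r) :=
  \mxblock_(a < n, b < n) (if (a <= b)%N then shiftT r ^+ (b - a) else 0).

Definition Lambda_mx (n r : nat) : 'M[int]_(\sum_(a < n) r) :=
  (bigT n r)^T *m (HD n r *+ 2) *m bigT n r.

Definition Lambda (n r : nat) (a : 'I_n) (j : 'I_r) (b : 'I_n) (k : 'I_r) : int :=
  Lambda_mx n r (tagnat.Rank a j) (tagnat.Rank b k).

(* The quasi-Laurent polynomial algebra generated by the quantum minors
   chi_(a,j) of the Dipper-Donkin algebra D_(q^2)(M(n,r)): it is the abstract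
   algebra on symbols chi_(a,j) and their inverses, subject only to the
   q-commutation relations satisfied by the minors, whose exponents are the
   entries of Lambda_mx. *)

Inductive chi_letter (n r : nat) : Type :=
| Chi of 'I_n & 'I_r
| ChiV of 'I_n & 'I_r.

Inductive chi_rel (K : fieldType) (q : K) (n r : nat) :
    term K (chi_letter n r) -> term K (chi_letter n r) -> Prop :=
| CR_mulV a j :
    chi_rel q (TMul (TGen (Chi a j)) (TGen (ChiV a j))) TOne
| CR_Vmul a j :
    chi_rel q (TMul (TGen (ChiV a j)) (TGen (Chi a j))) TOne
| CR_comm a j b k :
    chi_rel q (TMul (TGen (Chi a j)) (TGen (Chi b k)))
      (TScale (q ^ Lambda a j b k) (TMul (TGen (Chi b k)) (TGen (Chi a j)))).

Notation quasi_laurent q n r := (pres_alg (@chi_rel _ q n r)).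

(* 1-based indices 1 <= a <= n and 1 <= j <= r; the value 1 at indices that
   are too large is junk. *)
Definition chi_at (K : fieldType) (q : K) (n r : nat)
    (l : 'I_n -> 'I_r -> chi_letter n r) (a j : nat) : quasi_laurent q n r :=
  if (insub a.-1, insub j.-1) is (Some a', Some j')
  then pres_gen _ (l a' j') else 1.

Definition chi (K : fieldType) (q : K) (n r a j : nat) : quasi_laurent q n r :=
  chi_at q (@Chi n r) a j.

Definition chiV (K : fieldType) (q : K) (n r a j : nat) : quasi_laurent q n r :=
  chi_at q (@ChiV n r) a j.

Lemma chiE (K : fieldType) (q : K) (n r : nat) (a : 'I_n) (j : 'I_r) :
  chi q n r a.+1 j.+1 = pres_gen _ (Chi a j).
Proof. by rewrite /chi /chi_at /= !valK. Qed.

Lemma chiVE (K : fieldType) (q : K) (n r : nat) (a : 'I_n) (j : 'I_r) :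
  chiV q n r a.+1 j.+1 = pres_gen _ (ChiV a j).
Proof. by rewrite /chiV /chi_at /= !valK. Qed.

Definition Zelt (K : fieldType) (q : K) (n r s x z i : nat) :
    quasi_laurent q n r :=
  (\prod_(0 <= k < x) chiV q n r (n - 1 - k * s)%N r) *
  (\prod_(0 <= k < x) chi q n r (n - 1 - i - k * s)%N r) *
  (\prod_(1 <= j < (x + z)%N) chiV q n r n (j * s)%N) *
  (\prod_(0 <= l < (x + z)%N) chi q n r n (i + l * s)%N).

(* Main.v *)
(* The words in the letters chi^{+-1} span the algebra, and conjugation by a
   letter multiplies a word by the power of q given by the pairing of exponent
   vectors through Lambda.  Since q is not a root of unity, a central element
   equals its component of trivial weight, i.e. it is a combination of words
   whose exponent vector lies in ker Lambda; as a word is determined up to a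
   power of q by its exponent vector, it remains to find a Z-basis of
   ker Lambda.  (Eigenvectors for distinct eigenvalues are independent, so a
   basis of the algebra is never needed.)

   The matrix T is unitriangular, so x is in ker Lambda iff y = T x is in
   ker H_D.  With 0-based indices and P_a(i) = y_a(0) + ... + y_a(i-1), the
   differences of consecutive rows of H_D y = 0 read
   P_{a+1}(i+1) = P_a(i) - P_a(r), so that P_a(i) = F(i + a r) - F(a r) where F
   extends P_0 to an (r+1)-periodic function; the remaining row says that F is
   also (n-1)-periodic, hence s-periodic.  The vector x = T^{-1} y then vanishes
   except for a = n-1 or j = r-1, and the step functions F(m) = [i <= m mod s],
   1 <= i < s, give the exponent vectors of the Z_i. *)

Require Import Defs.
From HB Require Import structures.
From mathcomp Require Import all_boot all_order all_algebra reals complex boolp.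
From mathcomp Require Import zify ring.

Set Implicit Arguments.
Unset Strict Implicit.
Unset Printing Implicit Defensive.

Import Order.TTheory GRing.Theory Num.Theory.
Local Open Scope ring_scope.

(** * Presented algebras: generated subalgebras and central elements *)

Section Presented.
Variables (K : comPzRingType) (X : Type) (rel : term K X -> term K X -> Prop).
Implicit Types (G : pres_alg rel -> Prop) (u v : pres_alg rel).

Lemma subalg_gen0 G : subalg_gen G 0.
Proof. by rewrite -(addNr 1) -scaleN1r; apply: SG_lin; apply: SG_one. Qed.

Lemma subalg_genZ G a u : subalg_gen G u -> subalg_gen G (a *: u).
Proof. by move=> Gu; rewrite -[_ *: _]addr0; apply: SG_lin => //; apply: subalg_gen0. Qed.

Lemma subalg_gen_sum G I (s : seq I) (P : pred I) (f : I -> pres_alg rel) :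
  (forall i, P i -> subalg_gen G (f i)) -> subalg_gen G (\sum_(i <- s | P i) f i).
Proof.
move=> Gf; elim/big_ind: _ => //; first exact: subalg_gen0.
by move=> u v Gu Gv; rewrite -[u]scale1r; apply: SG_lin.
Qed.

Lemma subalg_gen_prod G I (s : seq I) (P : pred I) (f : I -> pres_alg rel) :
  (forall i, P i -> subalg_gen G (f i)) -> subalg_gen G (\prod_(i <- s | P i) f i).
Proof. by move=> Gf; elim/big_ind: _ => //; [apply: SG_one | apply: SG_mul]. Qed.

Lemma subalg_genX G u k : subalg_gen G u -> subalg_gen G (u ^+ k).
Proof.
move=> Gu; elim: k => [|k IHk]; first exact: SG_one.
by rewrite exprS; apply: SG_mul.
Qed.

(** This serves as the induction principle for elements of a presented algebra. *)
Lemma pres_alg_generated u : subalg_gen (fun v => exists x, v = pres_gen rel x) u.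
Proof.
rewrite -[u]pres_reprK; elim: (pres_repr u) => [x||s IHs|s IHs t IHt|a s IHs||s IHs t IHt].
- by apply: SG_gen; exists x.
- exact: subalg_gen0.
- rewrite pres_class_opp; have -> v : pres_opp v = -1 *: v by rewrite scaleN1r.
  exact: subalg_genZ.
- rewrite pres_class_add.
  have -> v w : pres_add v w = 1 *: v + w by rewrite scale1r.
  exact: SG_lin.
- by rewrite pres_class_scale; apply: subalg_genZ.
- exact: SG_one.
- by rewrite pres_class_mul; apply: SG_mul.
Qed.

Lemma commZr a u v : GRing.comm u v -> GRing.comm u (a *: v).
Proof. by rewrite /GRing.comm -pres_scalerAr -pres_scalerAl => ->. Qed.

Lemma central_gen u : (forall x, GRing.comm u (pres_gen rel x)) -> central u.
Proof.
move=> cu v; elim: (pres_alg_generated v) => {v} [_ [x ->]||a v w _ cv _ cw|v w _ cv _ cw].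
- exact: cu.
- exact: commr1.
- by apply: commrD => //; apply: commZr.
- exact: commrM.
Qed.

Lemma subalg_gen_central G u :
  (forall v, G v -> central v) -> subalg_gen G u -> central u.
Proof.
move=> cG; elim=> {u} [u /cG //|v|a v w _ cv _ cw u|v w _ cv _ cw u].
- exact/commr_sym/commr1.
- by apply/commr_sym/commrD; [apply/commZr/commr_sym/cv | apply/commr_sym/cw].
- by apply/commr_sym/commrM; apply/commr_sym.
Qed.

End Presented.

Lemma is_inverse_central (A : pzRingType) (u v : A) :
  is_inverse u v -> central u -> central v.
Proof.
move=> [uv vu] cu w.
by rewrite /GRing.comm -[LHS]mulr1 -uv mulrA -(mulrA v) -cu mulrA vu mul1r.
Qed.

(* Eigenvectors for eigenvalues other than 1 are independent of the fixed
   vectors: if [v] is the first term, then [f w - mu *: w] expresses a nonzero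
   multiple of [w] by the remaining terms. *)
Lemma fixed_eigensum0 (K : fieldType) (V : lmodType K) (I : Type) (s : seq I)
    (f : {linear V -> V}) (mu : I -> K) (v : I -> V) :
    (forall i, f (v i) = mu i *: v i) -> (forall i, mu i = 1 -> v i = 0) ->
  f (\sum_(i <- s) v i) = \sum_(i <- s) v i -> \sum_(i <- s) v i = 0.
Proof.
elim: s v => [|i0 s IHs] v fv v0; first by rewrite big_nil.
have [mu1|mu1] := eqVneq (mu i0) 1.
  by rewrite big_cons v0 // add0r; apply: IHs.
set w := \sum_(i <- _) _ => fw.
have c0 : 1 - mu i0 != 0 by rewrite subr_eq0 eq_sym.
pose v' i := ((1 - mu i0)^-1 * (mu i - mu i0)) *: v i.
have wE : w = \sum_(i <- s) v' i.
  under eq_bigr do rewrite /v' -scalerA scalerBl.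
  rewrite -scaler_sumr sumrB -scaler_sumr.
  have -> : \sum_(i <- s) v i = w - v i0 by rewrite /w big_cons addrC addKr.
  have -> : \sum_(i <- s) mu i *: v i = w - mu i0 *: v i0.
    rewrite -[X in _ = X - _]fw -fv -linearB /w big_cons addrC addKr raddf_sum /=.
    by apply: eq_bigr => i _; rewrite fv.
  rewrite (scalerBr (mu i0)) opprB addrA subrK -{2}[w]scale1r -scalerBl.
  by rewrite scalerA mulVf // scale1r.
rewrite wE; apply: IHs => [i|i /v0 vi0|]; last by rewrite -wE.
  by rewrite /v' linearZ /= fv !scalerA mulrC.
by rewrite /v' vi0 scaler0.
Qed.

Lemma fixed_eigensum (K : fieldType) (V : lmodType K) (I : Type) (s : seq I)
    (f : {linear V -> V}) (mu : I -> K) (v : I -> V) :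
    (forall i, f (v i) = mu i *: v i) ->
    f (\sum_(i <- s) v i) = \sum_(i <- s) v i ->
  \sum_(i <- s) v i = \sum_(i <- s | mu i == 1) v i.
Proof.
move=> fv; rewrite (bigID (fun i => mu i == 1)) /= raddfD /=.
set w := \sum_(i <- s | mu i == 1) v i.
have -> : f w = w.
  by rewrite raddf_sum /=; apply: eq_bigr => i /eqP mu1; rewrite fv mu1 scale1r.
move=> /addrI; rewrite big_mkcond /= => fs.
rewrite (fixed_eigensum0 (f := f) (mu := mu)) ?addr0 // => i.
  by case: ifP; rewrite ?fv // raddf0 scaler0.
by move=> ->; rewrite eqxx.
Qed.

(** * Words in the letters, their exponent vectors, and the center *)

Section Words.
Variables (K : fieldType) (q : K) (n r : nat).
Hypothesis q0 : q != 0.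
Local Notation A := (quasi_laurent q n r).
Local Notation letter := (chi_letter n r).
Local Notation gen := (pres_gen (@chi_rel _ q n r)).
Implicit Types (l : letter) (w : seq letter) (u v : A).

Definition letter_index l : 'I_(\sum_(a < n) r) :=
  match l with Chi a j => tagnat.Rank a j | ChiV a j => tagnat.Rank a j end.

Definition letter_sign l : int := if l is Chi _ _ then 1 else -1.

Definition letter_inv l : letter :=
  match l with Chi a j => ChiV a j | ChiV a j => Chi a j end.

Definition letter_exp l : 'cV[int]_(\sum_(a < n) r) :=
  letter_sign l *: delta_mx (letter_index l) 0.

Definition word_val w : A := \prod_(l <- w) gen l.
Definition word_exp w := \sum_(l <- w) letter_exp l.

Definition qcomm u v (k : int) := u * v = q ^ k *: (v * u).

(** The bilinear extension of [Lambda] to exponent vectors; it gives the power of [q] gained when a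
    letter passes a word. *)
Definition weight (x y : 'cV[int]_(\sum_(a < n) r)) : int :=
  (x^T *m Lambda_mx n r *m y) 0 0.

Lemma letter_exp_inv l : letter_exp (letter_inv l) = - letter_exp l.
Proof. by case: l => a j; rewrite /letter_exp /= scaleN1r scale1r ?opprK. Qed.

Lemma gen_inverse l : is_inverse (gen l : A) (gen (letter_inv l)).
Proof.
by case: l => a j; split; rewrite /GRing.mul /= -pres_class_mul;
  apply/pres_classP/PE_rel; constructor.
Qed.

Lemma gen_mulV l : gen l * gen (letter_inv l) = 1.
Proof. by case: (gen_inverse l). Qed.

Lemma qcomm_sym u v k : qcomm u v k -> qcomm v u (- k).
Proof.
by rewrite /qcomm => ->; rewrite scalerA -expfzDr // addNr expr0z scale1r.
Qed.

Lemma qcomm1 u : qcomm u 1 0.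
Proof. by rewrite /qcomm mulr1 mul1r expr0z scale1r. Qed.

Lemma qcommM u v v' k m : qcomm u v k -> qcomm u v' m -> qcomm u (v * v') (k + m).
Proof.
rewrite /qcomm => uv uv'; rewrite mulrA uv -pres_scalerAl -mulrA uv'.
by rewrite -pres_scalerAr scalerA -expfzDr // mulrA.
Qed.

Lemma qcommV u v v' k : is_inverse v v' -> qcomm u v k -> qcomm u v' (- k).
Proof.
move=> [vv' v'v] /qcomm_sym vu.
rewrite /qcomm -[LHS]mul1r -v'v -!mulrA [v * _]mulrA vu.
by rewrite -pres_scalerAl -pres_scalerAr -!mulrA vv' mulr1.
Qed.

(** Only the case of two letters [Chi] is a defining relation. Inverting either side negates the
    exponent, which yields the other three cases. *)
Lemma qcomm_gen l l' : qcomm (gen l) (gen l') (weight (letter_exp l) (letter_exp l')).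
Proof.
have weightE m m' : weight (letter_exp m) (letter_exp m') =
    letter_sign m * letter_sign m' * Lambda_mx n r (letter_index m) (letter_index m').
  rewrite /weight /letter_exp !linearZ /= -scalemxAl trmx_delta -rowE -colE.
  by rewrite -linearZ !mxE; ring.
have ChiChi a j b k : qcomm (gen (Chi a j)) (gen (Chi b k)) (Lambda a j b k).
  rewrite /qcomm /GRing.mul /= -!pres_class_mul /GRing.scale /= -pres_class_scale.
  exact/pres_classP/PE_rel/CR_comm.
have inv m := gen_inverse m.
rewrite weightE; case: l l' => [a j|a j] [b k|b k] /=.
- by rewrite !mul1r; apply: ChiChi.
- by rewrite mul1r mulN1r; apply: qcommV (inv (Chi b k)) (ChiChi a j b k).
- rewrite mulr1 mulN1r -[- _]opprK; apply: qcomm_sym.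
  exact: qcommV (inv (Chi a j)) (qcomm_sym (ChiChi a j b k)).
- rewrite mulrNN !mul1r.
  have /qcomm_sym VV := qcommV (inv (Chi b k)) (ChiChi a j b k).
  by have := qcomm_sym (qcommV (inv (Chi a j)) VV); rewrite !opprK.
Qed.

Lemma qcomm_gen_word l w : qcomm (gen l) (word_val w) (weight (letter_exp l) (word_exp w)).
Proof.
rewrite /word_val /word_exp; elim: w => [|m w IHw].
  by rewrite !big_nil /weight mulmx0 mxE; apply: qcomm1.
by rewrite !big_cons /weight mulmxDr mxE; apply: qcommM IHw; apply: qcomm_gen.
Qed.

Lemma word_val1 l : word_val [:: l] = gen l.
Proof. exact: big_seq1. Qed.

Lemma word_val_cat w w' : word_val (w ++ w') = word_val w * word_val w'.
Proof. exact: big_cat. Qed.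

Lemma word_exp_cat w w' : word_exp (w ++ w') = word_exp w + word_exp w'.
Proof. exact: big_cat. Qed.

Definition word_inv w := rev (map letter_inv w).

Lemma word_exp_inv w : word_exp (word_inv w) = - word_exp w.
Proof.
rewrite /word_exp /word_inv big_rev big_map -sumrN.
by apply: eq_bigr => l _; rewrite letter_exp_inv.
Qed.

Lemma word_val_inverse w : is_inverse (word_val w) (word_val (word_inv w)).
Proof.
elim: w => [|l w [IH1 IH2]]; first by rewrite /word_val big_nil; split; apply: mulr1.
have [l1 l2] := gen_inverse l.
rewrite /word_inv /= rev_cons -cats1 word_val_cat -/(word_inv w).
rewrite -[l :: w]cat1s word_val_cat.
rewrite !word_val1.
split; first by rewrite mulrA -(mulrA (gen l)) IH1 mulr1.
by rewrite mulrA -(mulrA _ _ (gen l)) l2 mulr1.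
Qed.

(** In the coordinate of [l], only [letter_inv l] contributes against the sign of [l]. So a word
    whose coordinate there has the opposite sign must contain [letter_inv l]. *)
Lemma letter_sign_coord_ge0 l l' : letter_inv l <> l' ->
  0 <= letter_sign l * letter_exp l' (letter_index l) 0.
Proof.
rewrite /letter_exp !mxE andbT => ll'.
have ge0 (b : bool) : 0 <= (b%:R : int) by rewrite ler0n.
case: l l' ll' => [a j|a j] [b k|b k] ll' /=; rewrite ?mulrA ?mulrNN ?mul1r ?mulr1 //;
  rewrite -val_eqE /= tagnat.eq_Rank; (case: eqP => [ab|] //=; try by rewrite mulr0);
  subst b; (case: eqP => [/val_inj jk|] //=; try by rewrite mulr0); by subst k; case: ll'.
Qed.

Lemma word_has_inv l w : letter_sign l * word_exp w (letter_index l) 0 < 0 ->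
  exists w1 w2, w = w1 ++ letter_inv l :: w2.
Proof.
elim: w => [|m w IHw]; first by rewrite /word_exp big_nil mxE mulr0 ltxx.
have [lm _|lm] := pselect (letter_inv l = m); first by exists [::], w; rewrite lm.
rewrite /word_exp big_cons mxE mulrDr => lt0; case: IHw => [|w1 [w2 ->]].
  by apply: le_lt_trans lt0; rewrite lerDr; apply: letter_sign_coord_ge0.
by exists (m :: w1), w2.
Qed.

(** Induction on the length: the first letter has its inverse later in the word; moving it there
    costs a power of [q], and the pair cancels. *)
Lemma word_exp0 w : word_exp w = 0 -> exists k : int, word_val w = q ^ k *: (1 : A).
Proof.
have [N] := ubnP (size w); elim: N w => // N IHN [|l w] /= ltN.
  by exists 0; rewrite expr0z scale1r /word_val big_nil.
rewrite -cat1s word_exp_cat => e0.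
have [|w1 [w2 wE]] := @word_has_inv l w.
  (* The total is zero, so the tail has coordinate [- letter_sign l] here. *)
  move/matrixP/(_ (letter_index l) 0): e0; rewrite /word_exp big_seq1 !mxE !eqxx.
  by move=> /(canRL (addKr _)) ->; case: (l).
rewrite {w}wE in ltN e0 *.
have e12 : word_exp (w1 ++ w2) = 0.
  rewrite -[RHS]e0 -[_ :: w2]cat1s !word_exp_cat.
  by rewrite /word_exp !big_seq1 letter_exp_inv [X in _ = _ + X]addrCA addNKr.
case: (IHN (w1 ++ w2)) => // [|k wk]; first by move: ltN; rewrite !size_cat /=; lia.
exists (weight (letter_exp l) (word_exp w1) + k); rewrite -[_ :: w2]cat1s.
rewrite !word_val_cat mulrA.
rewrite !word_val1.
rewrite qcomm_gen_word -pres_scalerAl -mulrA [gen l * _]mulrA gen_mulV mul1r.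
by rewrite -word_val_cat wk scalerA -expfzDr.
Qed.

Lemma word_exp_inj w w' : word_exp w = word_exp w' ->
  exists k : int, word_val w = q ^ k *: word_val w'.
Proof.
move=> ww'; have [|k wk] := @word_exp0 (w ++ word_inv w').
  by rewrite word_exp_cat word_exp_inv ww' subrr.
exists k; have [_ w'1] := word_val_inverse w'.
by rewrite -[LHS]mulr1 -w'1 mulrA -word_val_cat wk -pres_scalerAl mul1r.
Qed.

Lemma span_words u : exists s : seq (K * seq letter),
  u = \sum_(p <- s) p.1 *: word_val p.2.
Proof.
elim: (pres_alg_generated u) => {u} [_ [l ->]||a u v _ [s ->] _ [t ->]|u v _ [s ->] _ [t ->]].
- by exists [:: (1, [:: l])]; rewrite big_seq1 scale1r /word_val big_seq1.
- by exists [:: (1, [::])]; rewrite big_seq1 scale1r /word_val big_nil.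
- exists ([seq (a * p.1, p.2) | p <- s] ++ t); rewrite big_cat big_map scaler_sumr.
  by congr (_ + _); apply: eq_bigr => p _; rewrite scalerA.
exists [seq (p.1 * p'.1, p.2 ++ p'.2) | p <- s, p' <- t].
rewrite big_allpairs_dep mulr_suml /=; apply: eq_bigr => p _.
rewrite mulr_sumr; apply: eq_bigr => p' _.
by rewrite word_val_cat -pres_scalerAl -pres_scalerAr scalerA.
Qed.

Lemma word_central w : Lambda_mx n r *m word_exp w = 0 -> central (word_val w).
Proof.
move=> Lw; apply: central_gen => l; have := qcomm_gen_word l w.
by rewrite /qcomm /weight -mulmxA Lw mulmx0 mxE expr0z scale1r => /esym.
Qed.

Definition conj_gen l u : A := gen l * u * gen (letter_inv l).

Fact conj_gen_linear l : linear (conj_gen l).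
Proof.
by move=> a u v; rewrite /conj_gen mulrDr mulrDl -pres_scalerAr -pres_scalerAl.
Qed.
HB.instance Definition _ l := GRing.isLinear.Build K A A *:%R (conj_gen l) (conj_gen_linear l).

Lemma conj_gen_word l w :
  conj_gen l (word_val w) = q ^ weight (letter_exp l) (word_exp w) *: word_val w.
Proof.
by rewrite /conj_gen qcomm_gen_word -pres_scalerAl -mulrA gen_mulV mulr1.
Qed.

Lemma conj_gen_central l u : central u -> conj_gen l u = u.
Proof. by move=> cu; rewrite /conj_gen -cu -mulrA gen_mulV mulr1. Qed.

Hypothesis q_nroot : forall m : nat, (0 < m)%N -> q ^+ m != 1.

Lemma expfz_eq1 (k : int) : (q ^ k == 1) = (k == 0).
Proof.
apply/eqP/eqP => [|->//]; case: k => [[//|m]|m].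
  by move=> /eqP; rewrite -exprnP (negPf (q_nroot _)).
by rewrite NegzE -exprnN => /eqP; rewrite invr_eq1 (negPf (q_nroot _)).
Qed.

(* The conjugations by the generators are simultaneously diagonal on words. *)
Lemma central_span_words u : central u -> exists s : seq (K * seq letter),
  u = \sum_(p <- s | Lambda_mx n r *m word_exp p.2 == 0) p.1 *: word_val p.2.
Proof.
move=> cu; have [s us] := span_words u; exists s.
pose wt i (p : K * seq letter) := (Lambda_mx n r *m word_exp p.2) i 0.
(* The words are filtered one coordinate of [Lambda_mx n r *m word_exp p.2] at a time: coordinate
   [i] gives the eigenvalue of conjugation by the generator of index [i], and this conjugation fixes
   [u]. *)
have step (I : seq 'I_(\sum_(a < n) r)) :
    u = \sum_(p <- s | all (fun i => wt i p == 0) I) p.1 *: word_val p.2.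
  elim: I => [//|i I ut].
  pose l := Chi (tagnat.sig1 i) (tagnat.sig2 i) : letter.
  have wtE p : wt i p = weight (letter_exp l) (word_exp p.2).
    rewrite /weight /letter_exp scale1r trmx_delta -mulmxA -rowE mxE.
    by rewrite /letter_index /= tagnat.sig2K.
  rewrite -big_filter in ut; rewrite [LHS]ut.
  rewrite (@fixed_eigensum _ _ _ _ (conj_gen l) (fun p => q ^ wt i p)) => [|p|].
  - by rewrite big_filter_cond; apply: eq_bigl => p; rewrite expfz_eq1 andbC.
  - by rewrite linearZ /= conj_gen_word wtE !scalerA mulrC.
  - by rewrite -ut; apply: conj_gen_central.
rewrite [LHS](step (index_enum _)); apply: eq_bigl => p.
apply/allP/eqP => [Ip|Lp i _]; last by rewrite /wt Lp mxE.
by apply/colP => i; rewrite [RHS]mxE; apply/eqP/Ip; rewrite mem_index_enum.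
Qed.

(** Relating elements to exponent vectors allows products to be handled additively, whatever the
    order of their factors. *)
Definition is_monomial u x := exists2 w, u = word_val w & x = word_exp w.

Lemma is_monomial1 : is_monomial 1 0.
Proof. by exists [::]; rewrite /word_val /word_exp big_nil. Qed.

Lemma is_monomialM u v x y :
  is_monomial u x -> is_monomial v y -> is_monomial (u * v) (x + y).
Proof.
by move=> [w -> ->] [w' -> ->]; exists (w ++ w'); rewrite ?word_val_cat ?word_exp_cat.
Qed.

Lemma is_monomial_prod I (s : seq I) (P : pred I) (f : I -> A) x :
  (forall i, P i -> is_monomial (f i) (x i)) ->
  is_monomial (\prod_(i <- s | P i) f i) (\sum_(i <- s | P i) x i).
Proof.
by move=> fx; elim/big_ind2: _ => //; [apply: is_monomial1 | move=> *; apply: is_monomialM].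
Qed.

Lemma is_monomialX u x k : is_monomial u x -> is_monomial (u ^+ k) (x *+ k).
Proof.
move=> ux; elim: k => [|k IHk]; first exact: is_monomial1.
by rewrite exprS mulrS; apply: is_monomialM.
Qed.

Lemma is_monomial_inverse u x : is_monomial u x ->
  exists2 v, is_inverse u v & is_monomial v (- x).
Proof.
move=> [w -> ->]; exists (word_val (word_inv w)); first exact: word_val_inverse.
by exists (word_inv w); rewrite ?word_exp_inv.
Qed.

Lemma is_monomial_unique u v x : is_monomial u x -> is_monomial v x ->
  exists k : int, u = q ^ k *: v.
Proof. by move=> [w -> ->] [w' -> /word_exp_inj]. Qed.

Lemma is_monomial_central u x :
  is_monomial u x -> Lambda_mx n r *m x = 0 -> central u.
Proof. by move=> [w -> ->]; apply: word_central. Qed.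

(** A central element is a combination of words with exponent in the kernel. Such an exponent is an
    integer combination of the [x i], so the word is a power of [q] times a product of powers of the
    [Z i] and their inverses. *)
Lemma center_generated (s : nat) (Z : nat -> A) x :
    (forall i, (1 <= i < s)%N -> is_monomial (Z i) (x i)) ->
    (forall i, (1 <= i < s)%N -> Lambda_mx n r *m x i = 0) ->
    (forall y, Lambda_mx n r *m y = 0 ->
       exists c : nat -> int, y = \sum_(1 <= i < s) x i *~ c i) ->
  forall u, central u <->
    subalg_gen (fun v => exists i : nat,
      (1 <= i < s)%N /\ (v = Z i \/ is_inverse (Z i) v)) u.
Proof.
move=> Zx Lx Lker u; split=> [cu|]; last first.
  apply: subalg_gen_central => v [i [i1s Zv]].
  have cZ := is_monomial_central (Zx i i1s) (Lx i i1s).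
  by case: Zv => [-> //|/is_inverse_central]; apply.
have [t ->] := central_span_words cu.
apply: subalg_gen_sum => -[a w] /eqP /Lker [c wc] /=.
apply: subalg_genZ; set G := subalg_gen _.
(* The range condition sits inside the existential so that a choice exists for every [i]; outside
   the range the value 1 is a dummy. *)
have Zpow i : exists v, (1 <= i < s)%N -> G v /\ is_monomial v (x i *~ c i).
  have [i1s|] := boolP (1 <= i < s)%N; last by exists 1.
  have Zi := Zx i i1s; have [V ZV Vx] := is_monomial_inverse Zi.
  case: (c i) => m.
    exists (Z i ^+ m) => _; split; last exact: is_monomialX.
    by apply/subalg_genX/SG_gen; exists i; split=> //; left.
  exists (V ^+ m.+1) => _; split; last first.
    by rewrite NegzE mulrNz -mulNrz; apply: is_monomialX.
  by apply/subalg_genX/SG_gen; exists i; split=> //; right.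
have {}Zpow i := cid (Zpow i).
have wZ : is_monomial (\prod_(1 <= i < s) sval (Zpow i)) (word_exp w).
  rewrite wc !big_nat; apply: is_monomial_prod => i i1s.
  by have [] := svalP (Zpow i) i1s.
have [k ->] : exists k : int, word_val w = q ^ k *: \prod_(1 <= i < s) sval (Zpow i).
  by apply: is_monomial_unique wZ; exists w.
apply: subalg_genZ; rewrite big_nat; apply: subalg_gen_prod => i i1s.
by have [] := svalP (Zpow i) i1s.
Qed.

End Words.

(** * Periodic integer functions *)

Definition periodic (s : nat) (F : nat -> int) := forall m, F (m + s)%N = F m.

Lemma periodicM s F k : periodic s F -> periodic (k * s) F.
Proof.
by move=> Fs m; elim: k => [|k <-]; rewrite ?addn0 // mulSn addnCA addnC Fs.
Qed.

Lemma periodic_dvd s t F : (s %| t)%N -> periodic s F -> periodic t F.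
Proof. by move=> /dvdnP[k ->]; apply: periodicM. Qed.

(** Bezout with natural coefficients: [ks * s = kt * t + gcdn s t]. *)
Lemma periodic_gcd s t F : (0 < s)%N -> periodic s F -> periodic t F ->
  periodic (gcdn s t) F.
Proof.
move=> s0 Fs Ft m; case: (egcdnP t s0) => ks kt kst _.
by rewrite -(periodicM kt Ft) -addnA [(gcdn _ _ + _)%N]addnC -kst periodicM.
Qed.

Lemma periodic_modn s F m : periodic s F -> F (m %% s)%N = F m.
Proof. by move=> Fs; rewrite [in RHS](divn_eq m s) addnC periodicM. Qed.

Lemma periodic_mod_eq s F m m' : periodic s F -> m = m' %[mod s] -> F m = F m'.
Proof. by move=> Fs mm'; rewrite -(periodic_modn m Fs) mm' periodic_modn. Qed.

(** * The integer kernel of [Lambda_mx] *)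

Section Kernel.
Variables (n r : nat).

(** Entries come from a function on all of [nat * nat], so indices can be shifted freely; values
    outside the [n] by [r] range do not matter. *)
Definition colv (y : nat -> nat -> int) : 'cV[int]_(\sum_(a < n) r) :=
  \mxcol_(a < n) \col_(j < r) y a j.

Lemma eq_colv y y' : (forall a j, (a < n)%N -> (j < r)%N -> y a j = y' a j) ->
  colv y = colv y'.
Proof. by move=> yy'; apply: eq_mxcol => a; apply/colP => j; rewrite !mxE yy'. Qed.

Lemma colv0 y : colv y = 0 -> forall a j, (a < n)%N -> (j < r)%N -> y a j = 0.
Proof.
move=> y0 a j an jr; have := congr1 (fun x => submxcol x (Ordinal an)) y0.
by rewrite mxcolK submxcol0 => /colP /(_ (Ordinal jr)); rewrite !mxE.
Qed.

Lemma colv_sum I (s : seq I) (P : pred I) (y : I -> nat -> nat -> int) :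
  \sum_(i <- s | P i) colv (y i) = colv (fun a j => \sum_(i <- s | P i) y i a j).
Proof.
apply/colP => k; rewrite summxE !mxE; apply: eq_bigr => i _.
by rewrite !mxE.
Qed.

Lemma colvN y : - colv y = colv (fun a j => - y a j).
Proof. by apply/colP => k; rewrite !mxE. Qed.

Lemma colvD y y' : colv y + colv y' = colv (fun a j => y a j + y' a j).
Proof. by apply/colP => k; rewrite !mxE. Qed.

Lemma colvMz y c : colv y *~ c = colv (fun a j => y a j * c).
Proof. by apply/colP => k; rewrite -scaler_int !mxE intz mulrC. Qed.

Lemma colv_surj x : exists y, x = colv y.
Proof.
exists (fun a j => if (insub a, insub j) is (Some a', Some j')
  then x (tagnat.Rank a' j') 0 else 0).
rewrite -[LHS]submxcolK; apply: eq_mxcol => a; apply/colP => j.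
by rewrite !mxE !valK.
Qed.

Lemma HD_colv y : HD n r *m colv y = colv (fun a i =>
  \sum_(a.+1 <= b < n) \sum_(0 <= j < i.+1) y b j
  - \sum_(0 <= b < a) \sum_(i <= j < r) y b j).
Proof.
rewrite mul_mxblock_mxrow; apply: eq_mxcol => a; apply/colP => i.
have MC b : (blockM r *m \col_j y b j) i 0 = \sum_(0 <= j < i.+1) y b j.
  rewrite mxE (big_nat_widen _ _ r) // big_mkord [RHS]big_mkcond.
  by apply: eq_bigr => j _; rewrite !mxE ltnS; case: leqP; rewrite ?oppr0 ?mul0r ?opprK ?mul1r.
have NC b : (blockN r *m \col_j y b j) i 0 = - \sum_(i <= j < r) y b j.
  rewrite mxE (big_nat_widenl _ 0) // big_mkord -sumrN [RHS]big_mkcond.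
  by apply: eq_bigr => j _; rewrite !mxE; case: leqP; rewrite ?mul0r ?mulN1r.
rewrite summxE [RHS]mxE (big_nat_widenl _ 0) // big_mkord -sumrN.
rewrite [X in _ + X](big_nat_widen _ _ n) ?big_mkord; last exact: ltnW.
rewrite [X in X + _]big_mkcond [X in _ + X]big_mkcond -big_split.
apply: eq_bigr => b _; case: (ltngtP a b) => [ab|ba|ab] /=.
- by rewrite addr0 MC.
- by rewrite add0r NC.
- by rewrite mul0mx mxE addr0.
Qed.

(** With [S] the block shift, [bigT] is the geometric series of the nilpotent matrix S ⊗ T, and this
    is 1 - S ⊗ T. *)
Definition bigT_inv : 'M[int]_(\sum_(a < n) r) :=
  \mxblock_(a < n, b < n)
    (if a == b then 1%:M : 'M[int]_r else if (b == a.+1 :> nat)%N then - shiftT r else 0).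

Lemma bigT_invK : bigT n r *m bigT_inv = 1%:M.
Proof.
rewrite mul_mxblock; apply/mxblockP => a b; rewrite mxblockK.
have -> : submxblock 1%:M a b = if a == b then 1%:M else 0 :> 'M[int]_r.
  apply/matrixP => i j; rewrite !mxE -val_eqE /= tagnat.eq_Rank.
  by case: (a == b); rewrite !mxE.
pose Tab c : 'M[int]_r := if (a <= c)%N then shiftT r ^+ (c - a) else 0.
rewrite (eq_bigr (fun c : 'I_n => (if c == b then Tab b else 0)
  - (if (b == c.+1 :> nat)%N then Tab c *m shiftT r else 0))); last first.
  move=> c _; have [->|cb] := eqVneq c b.
    by rewrite mulmx1 (ltn_eqF (ltnSn b)) subr0.
  by case: eqP => _; rewrite ?mulmxN ?mulmx0 sub0r ?oppr0.
rewrite sumrB -big_mkcond big_pred1_eq.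
(* The two remaining terms are consecutive powers of [shiftT r], which cancel off the diagonal. *)
have Tb : Tab b - (if (b == 0 :> nat)%N then 0 else Tab b.-1 *m shiftT r)
    = if a == b then 1%:M else 0.
  rewrite /Tab -val_eqE /=; case: (b : nat) => [|c] /=.
    by rewrite leqn0 sub0n expr0 subr0.
  case: (ltngtP a c.+1) => [ac|ca|->].
  - by rewrite -ltnS ac subSn // exprSr subrr.
  - by rewrite leqNgt (ltnW ca) mul0mx subr0.
  - by rewrite subnn expr0 ltnn mul0mx subr0.
rewrite -[RHS]Tb; congr (_ - _); case: eqP => [b0|/eqP b0].
  by apply: big1 => c _; rewrite b0.
have bn : (b.-1 < n)%N by apply: leq_ltn_trans (leq_pred b) _.
rewrite (bigD1 (Ordinal bn)) //= prednK ?lt0n // eqxx big1 ?addr0 // => c.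
rewrite -val_eqE /= => cb; case: eqP => // bc.
by rewrite bc eqxx in cb.
Qed.

Lemma bigT_inv_colv y : bigT_inv *m colv y = colv (fun a j =>
  y a j - if (a.+1 < n)%N && (j.+1 < r)%N then y a.+1 j.+1 else 0).
Proof.
rewrite mul_mxblock_mxrow; apply: eq_mxcol => a; apply/colP => j.
have SC b : (shiftT r *m \col_j y b j) j 0 = if (j.+1 < r)%N then y b j.+1 else 0.
  rewrite mxE; case: ifP => jr; last first.
    apply: big1 => k _; rewrite !mxE; case: eqP => [kj|]; last by rewrite mul0r.
    by have := ltn_ord k; rewrite kj jr.
  rewrite (bigD1 (Ordinal jr)) //= big1 => [|k]; first by rewrite !mxE eqxx mul1r addr0.
  by rewrite -val_eqE /= !mxE => /negPf->; rewrite mul0r.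
rewrite summxE mxE.
rewrite (eq_bigr (fun b : 'I_n => (if b == a then y a j else 0)
  - (if (b == a.+1 :> nat)%N then if (j.+1 < r)%N then y b j.+1 else 0 else 0))); last first.
  move=> b _; have [<-|ab] := eqVneq a b.
    by rewrite mul1mx mxE (ltn_eqF (ltnSn a)) subr0.
  by case: eqP => _; rewrite ?mulNmx ?mul0mx mxE ?SC sub0r ?oppr0.
rewrite sumrB -big_mkcond big_pred1_eq; congr (_ - _).
case: (ltnP a.+1 n) => [an|na] /=; last first.
  by apply: big1 => b _; case: eqP => // ba; have := ltn_ord b; rewrite ba ltnNge na.
rewrite (bigD1 (Ordinal an)) //= big1 => [|b]; first by rewrite eqxx addr0.
by rewrite -val_eqE /= => /negPf->.
Qed.

(** The transpose of [bigT] is invertible, and the factor 2 cancels because the integers have no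
    torsion. *)
Lemma Lambda_ker (x : 'cV[int]_(\sum_(a < n) r)) :
  Lambda_mx n r *m x = 0 <-> HD n r *m (bigT n r *m x) = 0.
Proof.
have [uT _] := mulmx1_unit bigT_invK.
rewrite /Lambda_mx -!mulmxA; split=> [|H0]; last first.
  by rewrite mulr2n !mulmxDl H0 addr0 mulmx0.
have uTt : (bigT n r)^T \in unitmx by rewrite unitmx_tr.
move=> /(congr1 (mulmx (invmx (bigT n r)^T))); rewrite mulKmx // mulmx0.
rewrite mulr2n mulmxDl => /colP H0; apply/colP => i.
by move: (H0 i); rewrite !mxE; lia.
Qed.

Section Periodic.
Variable s : nat.
Hypotheses (r0 : (0 < r)%N) (n0 : (0 < n)%N) (hs : s = gcdn r.+1 n.-1).

(* For an (r+1)-periodic [F], adding [a * r] to the argument subtracts [a]. *)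
Definition stepv (F : nat -> int) := fun a j : nat => F (j + a * r).+1 - F (j + a * r)%N.

Lemma sum_stepv F a i : \sum_(0 <= j < i) stepv F a j = F (i + a * r)%N - F (a * r)%N.
Proof. by rewrite (telescope_sumr (fun j => F (j + a * r)%N)). Qed.

Let s_r1 : (s %| r.+1)%N. Proof. by rewrite hs dvdn_gcdl. Qed.
Let s_n1 : (s %| n.-1)%N. Proof. by rewrite hs dvdn_gcdr. Qed.

Lemma HD_stepv F : periodic s F -> HD n r *m colv (stepv F) = 0.
Proof.
move=> Fs; rewrite HD_colv -[RHS](_ : colv (fun _ _ => 0) = 0); last first.
  by apply/colP => i; rewrite !mxE.
apply: eq_colv => a i an ir.
have Fr := periodic_dvd s_r1 Fs; have Fn := periodic_dvd s_n1 Fs.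
(* Row [i] of every block will read [W i - W r]. The sum [W] is constant: shifting by [r] replaces
   its first term by one at distance [n.-1 * r], which is equal, while shifting by [r.+1] changes
   nothing. *)
pose W m := \sum_(0 <= b < n.-1) F (m + b * r)%N.
have Wr m : W (m + r.+1)%N = W m by apply: eq_bigr => b _; rewrite addnAC Fr.
have WS m : W m.+1 = W m.
  rewrite -[RHS]Wr -[m.+1]addn0 addnS -addSn.
  have -> : W (m.+1 + r)%N = \sum_(1 <= b < n.-1.+1) F (m.+1 + b * r)%N.
    by rewrite big_add1; apply: eq_bigr => b _; rewrite mulSn addnA.
  apply: (@addrI _ (F (m.+1 + 0 * r)%N)); rewrite -big_ltn // big_nat_recr //= addrC.
  by rewrite /W addn0 [(n.-1 * r)%N]mulnC periodicM.
have Wi : W i = W r.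
  have W0 m : W m = W 0%N by elim: m => // m <-.
  by rewrite !W0.
have -> : \sum_(a.+1 <= b < n) \sum_(0 <= j < i.+1) stepv F b j =
    \sum_(a <= b < n.-1) (F (i + b * r)%N - F (r + b * r)%N).
  rewrite -{1}(prednK n0) big_add1 /=; apply: eq_bigr => b _.
  rewrite sum_stepv mulSn; congr (_ - _).
  by rewrite -[RHS]Fr; congr (F _); lia.
have -> : \sum_(0 <= b < a) \sum_(i <= j < r) stepv F b j =
    \sum_(0 <= b < a) (F (r + b * r)%N - F (i + b * r)%N).
  apply: eq_bigr => b _.
  by rewrite (telescope_sumr (fun j => F (j + b * r)%N)) // ltnW.
rewrite -sumrN; under [X in _ + X]eq_bigr do rewrite opprB.
rewrite addrC -big_cat_nat //=; last by lia.
by rewrite sumrB -/(W i) -/(W r) Wi subrr.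
Qed.

Lemma HD_ker y : HD n r *m colv y = 0 ->
  exists2 F, periodic s F & colv y = colv (stepv F).
Proof.
rewrite HD_colv => /colv0 Hy.
pose P b i := \sum_(0 <= j < i) y b j.
have PK a i : (a < n)%N -> (i < r)%N ->
    \sum_(a.+1 <= b < n) P b i.+1 = \sum_(0 <= b < a) (P b r - P b i).
  move=> an ir; have /eqP := Hy a i an ir; rewrite subr_eq0 => /eqP ->.
  apply: eq_bigr => b _.
  by rewrite /P [in RHS](big_cat_nat (n := i)) ?(ltnW ir) //= addrAC subrr add0r.
(* Subtract the equations [PK] for the blocks [a] and [a.+1]. *)
have Prec a i : (a.+1 < n)%N -> (i < r)%N -> P a.+1 i.+1 = P a i - P a r.
  move=> an ir; have := PK _ _ an ir; have := PK _ _ (ltnW an) ir.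
  by rewrite big_ltn // [in X in _ -> X]big_nat_recr //= => <-; lia.
pose F m := P 0%N (m %% r.+1)%N.
have Fr : periodic r.+1 F by move=> m; rewrite /F modnDr.
have PF a i : (a < n)%N -> (i <= r)%N -> P a i = F (i + a * r)%N - F (a * r)%N.
  elim: a i => [|a IHa] i an ir.
    rewrite mul0n addn0 /F mod0n modn_small // [X in _ - X](_ : _ = 0) ?subr0 //.
    by rewrite /P big_geq.
  case: i ir => [|i] ir; first by rewrite add0n subrr /P big_geq.
  rewrite Prec ?IHa ?(ltnW an) ?(ltnW ir) // opprB addrA subrK.
  by congr (_ - _); rewrite -[LHS]Fr; congr (F _); lia.
(* The equations of block 0, whose right-hand side is empty, say that [W] is constant. Comparing
   [W m] with [W (m + r)] then equates the terms at the two ends. *)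
pose W m := \sum_(1 <= b < n) F (m + b * r)%N.
have Wmod m : W (m %% r.+1)%N = W m.
  by apply: eq_bigr => b _; apply: (periodic_mod_eq Fr); rewrite modnDml.
have W0 m : W m = W 0%N.
  rewrite -Wmod; have := ltn_pmod m (ltn0Sn r); case: (m %% r.+1)%N => [//|i] ir.
  have := PK 0%N i n0 ir; rewrite [RHS]big_geq // => PK0.
  apply/eqP; rewrite -subr_eq0 -sumrB -[X in _ == X]PK0; apply/eqP.
  by apply: eq_big_nat => b /andP[_ bn]; rewrite PF // add0n.
have Fnr m : F (m + n * r)%N = F (m + r)%N.
  have : W m + F (m + n * r)%N = F (m + r)%N + W (m + r)%N.
    rewrite /W -big_nat_recr //= big_ltn // mul1n; congr (_ + _).
    by rewrite big_add1 /=; apply: eq_bigr => b _; rewrite mulSn addnA.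
  by rewrite W0 (W0 (m + r)%N) addrC => /addIr.
have Fn : periodic n.-1 F.
  move=> m; rewrite -[LHS]Fr -[RHS](periodicM n Fr).
  (* Modulo the period [r.+1], the shift [n.-1] becomes [n + r], then [n + n * r] by [Fnr], which is
     a multiple of [r.+1]. *)
  have -> : (m + n.-1 + r.+1 = m + n + r)%N by lia.
  by rewrite -Fnr mulnS addnA.
have Fs : periodic s F by rewrite hs; apply: periodic_gcd.
exists F => //; apply: eq_colv => a j an jr.
have -> : y a j = P a j.+1 - P a j by rewrite /P big_nat_recr //= addrC addrK.
by rewrite !PF // ?(ltnW jr) // opprB addrA subrK.
Qed.

Lemma stepv_ker (x : 'cV[int]_(\sum_(a < n) r)) : Lambda_mx n r *m x = 0 <->
  exists2 F, periodic s F & bigT n r *m x = colv (stepv F).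
Proof.
rewrite Lambda_ker; split=> [|[F Fs ->]]; last exact: HD_stepv.
by have [y ->] := colv_surj (bigT n r *m x); apply: HD_ker.
Qed.

(** For [s]-periodic [F] this is the preimage of [colv (stepv F)] under [bigT]: moving from [(a, j)]
    to [(a.+1, j.+1)] shifts the argument by [r.+1], so all entries cancel except in the last block
    and at the last position of each block. *)
Definition cornerv (F : nat -> int) :=
  colv (fun a j => if (a.+1 < n)%N && (j.+1 < r)%N then 0 else stepv F a j).

Lemma Lambda_kerP (x : 'cV[int]_(\sum_(a < n) r)) : Lambda_mx n r *m x = 0 <->
  exists2 F, periodic s F & x = cornerv F.
Proof.
rewrite stepv_ker; have TVT := mulmx1C bigT_invK.
have cornerE F : periodic s F -> bigT_inv *m colv (stepv F) = cornerv F.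
  move=> Fs; rewrite bigT_inv_colv; apply: eq_colv => a j an jr.
  case: ifP; rewrite ?subr0 // => _; rewrite /stepv.
  have Fr := periodic_dvd s_r1 Fs.
  apply/eqP; rewrite subr_eq0 mulSn; apply/eqP; congr (_ - _).
    by rewrite -[LHS]Fr; congr (F _); lia.
  by rewrite -[LHS]Fr; congr (F _); lia.
split=> -[F Fs xF]; exists F => //.
  by rewrite -cornerE // -xF mulmxA TVT mul1mx.
by rewrite xF -cornerE // mulmxA bigT_invK mul1mx.
Qed.

(** For [1 <= i < s] these span the [s]-periodic functions modulo constants, and [stepv] kills
    constants. *)
Definition step_at (i m : nat) : int := (i <= m %% s)%N%:R.

Hypothesis s1 : (0 < s)%N.

Lemma step_at_periodic i : periodic s (step_at i).
Proof. by move=> m; rewrite /step_at modnDr. Qed.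

(** The sum telescopes: the steps equal to 1 are those with [i <= m %% s]. *)
Lemma periodic_step_sum F m : periodic s F ->
  F m = F 0%N + \sum_(1 <= i < s) step_at i m * (F i - F i.-1).
Proof.
move=> Fs; rewrite -(periodic_modn m Fs) /step_at.
have := ltn_pmod m s1; move: (m %% s)%N => k ks.
rewrite (big_cat_nat (n := k.+1)) //= [X in _ + (_ + X)]big_nat_cond.
rewrite [X in _ + (_ + X)]big1 => [|i]; last first.
  by rewrite andbT => /andP[ki _]; rewrite leqNgt ki mul0r.
rewrite addr0 big_add1 /= -[LHS](subrK (F 0%N)) addrC -(telescope_sumr F) //.
congr (_ + _); apply: eq_big_nat => i /andP[_ ik].
by rewrite ik mul1r.
Qed.

Lemma cornerv_span F : periodic s F ->
  cornerv F = \sum_(1 <= i < s) cornerv (step_at i) *~ (F i - F i.-1).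
Proof.
move=> Fs; rewrite [RHS](eq_bigr _ (fun i _ => colvMz _ _)) colv_sum.
apply: eq_colv => a j _ _; case: ifP => _.
  by rewrite big1 // => i _; rewrite mul0r.
rewrite /stepv (periodic_step_sum _ Fs) [X in _ - X](periodic_step_sum _ Fs).
rewrite opprD addrACA subrr add0r -sumrB.
by apply: eq_bigr => i _; rewrite mulrBl.
Qed.

End Periodic.
End Kernel.

(** * Exponent vectors of the elements [Zelt] *)

Lemma count_progression (N s i m : nat) : (i < s)%N ->
  \sum_(0 <= l < N) ((m == i + l * s)%N%:R : int) = ((m < N * s) && (m %% s == i))%N%:R.
Proof.
move=> si; have s0 : (0 < s)%N by apply: leq_ltn_trans si.
elim: N => [|N IHN]; first by rewrite big_geq.
rewrite big_nat_recr //= IHN -!ltn_divLR // ltnS [in RHS]leq_eqVlt.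
have -> : (m == i + N * s)%N = (m %/ s == N)%N && (m %% s == i)%N.
  apply/eqP/andP => [->|[/eqP <- /eqP <-]]; last by rewrite addnC -divn_eq.
  by rewrite addnC divnMDl // divn_small // modnMDl modn_small ?addn0 ?eqxx.
by case: (ltngtP (m %/ s)%N N) => _ /=; rewrite ?addr0 ?add0r.
Qed.

Section CentralMonomials.
Variables (K : fieldType) (q : K) (n r s x z : nat).
Hypotheses (n0 : (0 < n)%N) (s1 : (1 < s)%N).
Hypotheses (hx : (n - 1 = x * s)%N) (hz : (r + 1 = (x + z) * s)%N).

(** The indices are 1-based, as in [chi]. *)
Definition unitv a j := colv n r (fun a' j' => ((a'.+1 == a) && (j'.+1 == j))%N%:R).

Lemma letter_exp_Chi (a : 'I_n) (j : 'I_r) : letter_exp (Chi a j) = unitv a.+1 j.+1.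
Proof.
apply/colP => k; rewrite /letter_exp scale1r !mxE eqxx andbT !eqSS.
by rewrite -{1}(tagnat.sig2K k) -val_eqE /= tagnat.eq_Rank.
Qed.

Lemma chi_monomial a j : (0 < a <= n)%N -> (0 < j <= r)%N ->
  is_monomial (chi q n r a j) (unitv a j).
Proof.
case: a j => [//|a] [|j] //= an jr; pose a' := Ordinal an; pose j' := Ordinal jr.
exists [:: Chi a' j']; first by rewrite word_val1 -chiE.
by rewrite /word_exp big_seq1 letter_exp_Chi.
Qed.

Lemma chiV_monomial a j : (0 < a <= n)%N -> (0 < j <= r)%N ->
  is_monomial (chiV q n r a j) (- unitv a j).
Proof.
case: a j => [//|a] [|j] //= an jr; pose a' := Ordinal an; pose j' := Ordinal jr.
exists [:: ChiV a' j']; first by rewrite word_val1 -chiVE.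
by rewrite /word_exp big_seq1 (letter_exp_inv (Chi a' j')) letter_exp_Chi.
Qed.

(** The step function rises on entering residue [i] and falls on wrapping around from [s.-1] to
    0. *)
Lemma step_at_diff i m : (0 < i < s)%N ->
  step_at s i m.+1 - step_at s i m = (m %% s == i.-1)%N%:R - (m %% s == s.-1)%N%:R.
Proof.
move=> /andP[i0 si]; rewrite /step_at.
have s0 : (0 < s)%N by lia.
have -> : (m.+1 %% s = if m %% s == s.-1 then 0 else (m %% s).+1)%N.
  rewrite -addn1 -modnDml; have := ltn_pmod m s0; case: eqP => [->|] ms.
    by rewrite addn1 prednK // modnn.
  by move=> ?; rewrite modn_small; lia.
have := ltn_pmod m s0; case: (eqVneq (m %% s)%N s.-1) => ms; case: eqP; case: leqP; case: leqP; lia.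
Qed.

(** Each of the four products contributes the signed indicator of a residue class modulo [s], two of
    them along column [r] and two along row [n]. These are the rises and falls of [step_at s i] on
    the corner. *)
Lemma Zelt_monomial i : (1 <= i < s)%N ->
  is_monomial (Zelt q n r s x z i) (cornerv n r (step_at s i)).
Proof.
move=> /andP[i0 si].
pose e := \sum_(0 <= k < x) - unitv (n - 1 - k * s)%N r
  + \sum_(0 <= k < x) unitv (n - 1 - i - k * s)%N r
  + \sum_(1 <= j < (x + z)%N) - unitv n (j * s)%N
  + \sum_(0 <= l < (x + z)%N) unitv n (i + l * s)%N.
have -> : cornerv n r (step_at s i) = e.
  rewrite /e !sumrN !colv_sum !colvN !colvD; apply: eq_colv => a j an jr.
  have -> : \sum_(0 <= k < x) ((a.+1 == n - 1 - k * s) && (j.+1 == r))%N%:R =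
      [&& a.+1 < n, j.+1 == r & a %% s == s.-1]%N%:R :> int.
    case: (j.+1 == r); last by rewrite big1 ?andbF // => k _; rewrite andbF.
    (* Since [n - 1 = x * s], reversing the product makes the 0-based rows an increasing progression
       from [s.-1]. *)
    rewrite big_nat_rev (eq_big_nat _ _ (F2 := fun k => (a == s.-1 + k * s)%N%:R)).
      by rewrite count_progression; [congr (_ && _)%:R|]; lia.
    by move=> k kx; rewrite andbT; congr (nat_of_bool _)%:R; nia.
  have -> : \sum_(0 <= k < x) ((a.+1 == n - 1 - i - k * s) && (j.+1 == r))%N%:R =
      [&& a.+1 < n, j.+1 == r & a %% s == s.-1 - i]%N%:R :> int.
    case: (j.+1 == r); last by rewrite big1 ?andbF // => k _; rewrite andbF.
    rewrite big_nat_rev (eq_big_nat _ _ (F2 := fun k => (a == s.-1 - i + k * s)%N%:R)).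
      by rewrite count_progression; [congr (_ && _)%:R|]; lia.
    by move=> k kx; rewrite andbT; congr (nat_of_bool _)%:R; nia.
  have -> : \sum_(1 <= j' < (x + z)%N) ((a.+1 == n) && (j.+1 == j' * s))%N%:R =
      ((a.+1 == n) && (j %% s == s.-1))%N%:R :> int.
    case: (a.+1 == n); last by rewrite big1.
    rewrite big_add1 (eq_big_nat _ _ (F2 := fun k => (j == s.-1 + k * s)%N%:R)).
      rewrite count_progression; last by lia.
      congr (nat_of_bool _)%:R; case: eqP => [js|]; rewrite ?andbF // andbT.
      (* The bound from the count is automatic: [j.+1] is a multiple of [s] below
         [r + 1 = (x + z) * s]. *)
      have jd : j.+1 = ((j %/ s).+1 * s)%N by rewrite {1}(divn_eq j s) js mulSn; lia.
      have: ((j %/ s).+1 * s < (x + z) * s)%N by rewrite -jd; lia.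
      rewrite ltn_pmul2r; last by lia.
      by move=> dxz; rewrite jd leq_pmul2r; lia.
    by move=> k kx /=; congr (nat_of_bool _)%:R; nia.
  have -> : \sum_(0 <= l < (x + z)%N) ((a.+1 == n) && (j.+1 == i + l * s))%N%:R =
      ((a.+1 == n) && (j %% s == i.-1))%N%:R :> int.
    case: (a.+1 == n); last by rewrite big1.
    rewrite (eq_big_nat _ _ (F2 := fun k => (j == i.-1 + k * s)%N%:R)).
      by rewrite count_progression; [congr (_ && _)%:R|]; lia.
    by move=> k kx; congr (nat_of_bool _)%:R; lia.
  have i0s : (0 < i < s)%N by rewrite i0.
  rewrite /stepv step_at_diff //.
  have [an1|an1|an1] := ltngtP a.+1 n; last 1 first.
  - rewrite /= oppr0 !add0r addrC.
    (* In the last row [a = x * s], so [a * r] vanishes modulo [s]. *)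
    have -> : (j + a * r = (x * r) * s + j)%N by rewrite (_ : a = x * s)%N; lia.
    by rewrite modnMDl.
  - rewrite !subr0 ?addr0 /=; case: (ltngtP j.+1 r) => [jr1|jr1|jr1] //=; first by lia.
    (* In the last column [j + a * r = a.+1 * r - 1], and [r] is -1 modulo [s]. The two residues
       plus 2 therefore add up to [s] or [2 * s], which matches the classes [i.-1] with [s.-1 - i]
       and [s.-1] with itself. *)
    have : (s %| (j + a * r) %% s + a %% s + 2)%N.
      rewrite /dvdn -addnA modnDml addnCA modnDml addnCA !addnA.
      by rewrite (_ : _ + 2 = a.+1 * (x + z) * s)%N ?modnMl //; nia.
    have s0 : (0 < s)%N by apply: ltnW.
    have := ltn_pmod (j + a * r) s0; have := ltn_pmod a s0.
    move: (_ %% s)%N (_ %% s)%N => a' m' a's m's /dvdnP[c E].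
    have c12 : (c = 1 \/ c = 2)%N by nia.
    by case: c12 E => -> E; lia.
  - by lia.
rewrite /Zelt /e; do !apply: is_monomialM; rewrite !big_nat; apply: is_monomial_prod => k kx.
- apply: chiV_monomial; nia.
- apply: chi_monomial; nia.
- apply: chiV_monomial; nia.
- apply: chi_monomial; nia.
Qed.

End CentralMonomials.

Theorem proposition5p3 (R : realType) (q : R[i]) (n r s x z : nat)
    (hq0 : q != 0) (hq : forall m : nat, (0 < m)%N -> q ^+ m != 1)
    (hn : (0 < n)%N) (hnr : (n <= r)%N)
    (hs : s = gcdn (r + 1) (n - 1)) (hs1 : (1 < s)%N)
    (hx : (n - 1 = x * s)%N) (hz : (r + 1 = (x + z) * s)%N) :
  forall u : quasi_laurent q n r,
    central u <->
    subalg_gen (fun v : quasi_laurent q n r =>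
      exists i : nat, (1 <= i <= s - 1)%N /\
        (v = Zelt q n r s x z i \/ is_inverse (Zelt q n r s x z i) v)) u.
Proof.
have r0 : (0 < r)%N := leq_trans hn hnr.
have hs' : s = gcdn r.+1 n.-1 by rewrite hs addn1 subn1.
have s0 : (0 < s)%N := ltnW hs1.
have is1 i : (1 <= i <= s - 1)%N = (1 <= i < s)%N by lia.
move=> u; under eq_fun => v do under eq_exists => i do rewrite is1.
apply: (center_generated hq0 hq (x := fun i => cornerv n r (step_at s i))) => [i||y].
- exact: Zelt_monomial.
- move=> i _; apply/(Lambda_kerP r0 hn hs').
  by exists (step_at s i) => //; apply: step_at_periodic.
(* The coefficients are the successive jumps of [F]. *)
- move=> /(Lambda_kerP r0 hn hs')[F Fs ->]; exists (fun i => F i - F i.-1).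
  exact: cornerv_span.
Qed.
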